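(* Let $s\in(0,1)$, let $\Omega\subset\mathbb{R}^n$ be a bounded open set with Lipschitz boundary, and fix a measurable set $E_0\subset\mathbb{R}^n\setminus\Omega$. Then there exists a measurable set $E\subset\mathbb{R}^n$ such that $E\setminus\Omega=E_0$ and $$P_s(E,\Omega)=\inf\{P_s(F,\Omega): F\subset\mathbb{R}^n\text{ measurable},\ F\setminus\Omega=E_0\}.$$
   Context: $\mathcal{C}E$ is the complement. For disjoint measurable $A,B$, $\mathcal{L}_s(A,B):=\int_A\int_B\frac{dx\,dy}{|x-y|^{n+s}}$, and the fractional $s$-perimeter of $E$ in $\Omega$ is $P_s(E,\Omega):=\mathcal{L}_s(E\cap\Omega,\mathcal{C}E)+\mathcal{L}_s(E\setminus\Omega,\mathcal{C}E\cap\Omega)$. *)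

(* Defs.v *)
From HB Require Import structures.
From mathcomp Require Import all_boot all_order all_algebra.
From mathcomp Require Import all_classical all_reals all_analysis.

Set Implicit Arguments.
Unset Strict Implicit.
Unset Printing Implicit Defensive.
Import Order.TTheory GRing.Theory Num.Theory.
Import numFieldNormedType.Exports.

Local Open Scope classical_set_scope.
Local Open Scope ring_scope.

(* R^n is 'rV[R]_n.+1, so that its dimension, n.+1, is at least 1.  Its library
   norm is the sup norm, which is only used for topological notions
   (open, bounded, closure, Lipschitz); Euclidean distances use [enorm]. *)
Definition enorm (R : realType) (m : nat) (x : 'rV[R]_m) : R :=
  Num.sqrt (\sum_(i < m) x 0 i ^+ 2).

Definition box (R : realType) (m : nat) (I : 'rV[R]_m * 'rV[R]_m) :
  set 'rV[R]_m := [set x | forall i, x 0 i \in `]I.1 0 i, I.2 0 i]].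

Definition box_volume (R : realType) (m : nat) (I : 'rV[R]_m * 'rV[R]_m) : R :=
  \prod_(i < m) (I.2 0 i - I.1 0 i).

Definition box_cover (R : realType) (m : nat) (A : set 'rV[R]_m) :
  set (nat -> 'rV[R]_m * 'rV[R]_m) :=
  [set I : nat -> 'rV[R]_m * 'rV[R]_m |
    (forall k i, (I k).1 0 i <= (I k).2 0 i) /\ A `<=` \bigcup_k box (I k)].

Definition lebesgue_outer (R : realType) (n : nat) (A : set 'rV[R]_n.+1) :
  \bar R :=
  ereal_inf [set (\sum_(k <oo) (box_volume (I k))%:E)%E | I in box_cover A].

Section lebesgue_outer_is_outer_measure.
Context (R : realType) (n : nat).
Local Open Scope ereal_scope.
Local Notation mu := (@lebesgue_outer R n).

Let volume_ge0 (I : 'rV[R]_n.+1 * 'rV[R]_n.+1) :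
  (forall i, I.1 0%R i <= I.2 0%R i)%R -> 0 <= (box_volume I)%:E.
Proof.
by move=> h; rewrite lee_fin; apply: prodr_ge0 => i _; rewrite subr_ge0.
Qed.

Lemma lebesgue_outer_ge0 A : 0 <= mu A.
Proof.
apply: le_ereal_inf_tmp => _ [I [I12 _] <-].
by apply: nneseries_ge0 => k _ _; exact: volume_ge0.
Qed.

Lemma lebesgue_outer0 : mu set0 = 0.
Proof.
apply/eqP; rewrite eq_le lebesgue_outer_ge0 andbT.
apply: ereal_inf_lbound; exists (fun=> (0, 0)%R) => //.
  by split=> [k i|x //]; rewrite lexx.
rewrite eseries0// => k _ _.
by rewrite /box_volume big_ord_recl subrr mul0r.
Qed.

Lemma le_lebesgue_outer : {homo mu : A B / A `<=` B >-> A <= B}.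
Proof.
move=> A B AB; apply: le_ereal_inf_tmp => _ [I [I12 BI] <-].
by apply: ereal_inf_lbound; exists I => //; split => //; exact: subset_trans BI.
Qed.

Lemma lebesgue_outer_sigma_subadditive : sigma_subadditive mu.
Proof.
move=> A; have [[i ioo]|] := pselect (exists i, mu (A i) = +oo).
  rewrite (eseries_pinfty _ _ ioo) ?leey// => k _.
  by rewrite -ltNye (lt_le_trans _ (lebesgue_outer_ge0 _)).
rewrite -forallNE => Aoo.
suff add2e (e : {posnum R}) :
    mu (\bigcup_n A n) <= \sum_(i <oo) mu (A i) + e%:num%:E.
  by apply/lee_addgt0Pr => _/posnumP[].
rewrite (le_trans _ (epsilon_trick _ _ _))//; last first.
  by move=> k; exact: lebesgue_outer_ge0.
pose P k (I : nat -> 'rV[R]_n.+1 * 'rV[R]_n.+1) := box_cover (A k) I /\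
  \sum_(j <oo) (box_volume (I j))%:E <= mu (A k) + (e%:num / (2 ^ k.+1)%:R)%:E.
have [G PG] : {G : nat -> nat -> 'rV[R]_n.+1 * 'rV[R]_n.+1 &
    forall k, P k (G k)}.
  apply: (@choice _ _ P) => k; rewrite /P /lebesgue_outer.
  set S := (X in ereal_inf X); move infS : (ereal_inf S) => iS.
  case: iS infS => [r Sr|Soo|Soo].
  - have en1 : (0 < e%:num / (2 ^ k.+1)%:R)%R by [].
    have /(lb_ereal_inf_adherent en1) : ereal_inf S \is a fin_num by rewrite Sr.
    move=> [x [B AB <-] xS].
    by exists B; split => //; rewrite -Sr; exact/ltW.
  - by have := Aoo k; rewrite /lebesgue_outer Soo.
  - by have := lebesgue_outer_ge0 (A k); rewrite /lebesgue_outer Soo.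
pose v (p : nat * nat) := (box_volume (G p.1 p.2))%:E.
have v_ge0 p : 0 <= v p by apply: volume_ge0; exact: (PG p.1).1.1.
apply: (@le_trans _ _ (\esum_(p in setT) v p)).
  have /card_esym/ppcard_eqP[f] := card_nat2.
  apply: ereal_inf_lbound; exists (fun k => G (f k).1 (f k).2).
    split=> [k i|]; first exact: (PG (f k).1).1.1.
    move=> t [i _ /((PG i).1.2)[j _ Gt]].
    by exists (f^-1%FUN (i, j)) => //=; rewrite invK ?inE.
  transitivity (\sum_(k <oo) v (f k)) => //.
  by rewrite -(esum_pred_image v _ xpredT) ?[fun=> _]set_true// image_eq.
rewrite (_ : esum _ _ = \sum_(i <oo) \sum_(j <oo) v (i, j)); last first.
  pose J : nat -> set (nat * nat) := fun i => [set (i, j) | j in setT].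
  rewrite (_ : setT = \bigcup_k J k); last first.
    by rewrite predeqE => -[a b]; split => // _; exists a => //; exists b.
  rewrite esum_bigcupT //=; last first.
    apply/trivIsetP => i j _ _ ij.
    rewrite predeqE => -[p q] /=; split => //= -[] [_] _ [<-{p} _].
    by move=> [m' _] [] /esym/eqP; rewrite (negbTE ij).
  rewrite -(image_id [set: nat]) -fun_true esum_pred_image//; last first.
    by move=> k _; exact: esum_ge0.
  apply: eq_eseriesr => /= j _.
  rewrite -(esum_pred_image v (pair j) predT)//=; last first.
    by move=> ? ? _ _; exact: (@can_inj _ _ _ snd).
  by congr esum; rewrite predeqE => -[a b]; split; move=> [i _ <-]; exists i.
apply: lee_nneseries => k _; first by move=> _; exact: nneseries_ge0.
exact: (PG k).2.
Qed.

HB.instance Definition _ := isOuterMeasure.Build R 'rV[R]_n.+1 mu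
  lebesgue_outer0 lebesgue_outer_ge0 le_lebesgue_outer
  lebesgue_outer_sigma_subadditive.

End lebesgue_outer_is_outer_measure.

Definition lebesgue_measurable (R : realType) (n : nat) :
  set (set 'rV[R]_n.+1) := (@lebesgue_outer R n).-cara.-measurable.

Definition lebesgue_rV (R : realType) (n : nat) :
  set (caratheodory_type (@lebesgue_outer R n)) -> \bar R :=
  @lebesgue_outer R n.
HB.instance Definition _ (R : realType) (n : nat) :=
  isMeasure.Build _ _ _ (@lebesgue_rV R n)
    (@caratheodory_measure0 R _ (@lebesgue_outer R n))
    (@caratheodory_measure_ge0 R _ (@lebesgue_outer R n))
    (@caratheodory_measure_sigma_additive R _ (@lebesgue_outer R n)).

(* Near each boundary point, in suitable orthonormal coordinates y = x *m Q,
   Omega is the part above the graph of a Lipschitz function of the first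
   n coordinates. *)
Definition lipschitz_boundary (R : realType) (n : nat)
    (Omega : set 'rV[R]_n.+1) : Prop :=
  forall p, (closure Omega `\` Omega°) p ->
  exists (Q : 'M[R]_n.+1) (g : 'rV[R]_n -> R^o),
    [/\ Q *m Q^T = 1%:M,
        lipschitz g &
        \forall x \near p,
          Omega x <-> g (col' ord_max (x *m Q)) < (x *m Q) 0 ord_max].

(* The kernel is evaluated as 0^-1 = 0 at x = y, which does not occur
   when A and B are disjoint. *)
Definition interaction (R : realType) (n : nat) (s : R)
    (A B : set 'rV[R]_n.+1) : \bar R :=
  (\int[@lebesgue_rV R n]_(x in A) \int[@lebesgue_rV R n]_(y in B)
     ((enorm ((x : 'rV[R]_n.+1) - (y : 'rV[R]_n.+1))
       `^ (n.+1%:R + s))^-1)%:E)%E.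

Definition frac_perimeter (R : realType) (n : nat) (s : R)
    (E Omega : set 'rV[R]_n.+1) : \bar R :=
  (interaction s (E `&` Omega) (~` E) +
   interaction s (E `\` Omega) (~` E `&` Omega))%E.

(* Main.v *)
(* The fractional perimeter is submodular: writing P_s(E, Omega) as the double
   integral of K(x, y) 1_E(x) 1_{CE}(y) for a fixed K >= 0, the pointwise
   inequality for indicators gives P(A u B) + P(A n B) <= P(A) + P(B).  If
   P(E_k) <= m + 2^-k, where m is the infimum, then P(A n B) >= m for
   competitors bounds P of every finite union of the E_k, k >= N, by
   m + 2 * 2^-N.  By Fatou's lemma this passes to the union of all E_k, k >= N,
   and then to the limit superior of the E_k, which is therefore a
   minimizer.  It remains to see that the kernel is measurable and Lebesgue
   measure sigma-finite, which follows from the Caratheodory measurability of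
   coordinate half-spaces. *)
From HB Require Import structures.
Require Import Defs.
From mathcomp Require Import all_boot all_order all_algebra.
From mathcomp Require Import all_classical all_reals all_analysis.
From mathcomp Require Import measurable_realfun ring lra.
Import Order.TTheory GRing.Theory Num.Theory.
Import numFieldNormedType.Exports.
Local Open Scope classical_set_scope.
Local Open Scope ring_scope.

(** * Minimization of submodular functionals on sets *)

Lemma submodular_has_minimum (R : realType) (T : Type) (C : set (set T))
    (J : set T -> \bar R) :
  C !=set0 ->
  (forall F : (set T)^nat, (forall k, C (F k)) -> C (\bigcup_k F k)) ->
  (forall F : (set T)^nat, (forall k, C (F k)) -> C (\bigcap_k F k)) ->
  setU_closed C -> setI_closed C ->
  (forall A, (0 <= J A)%E) ->
  (forall A B, C A -> C B -> (J (A `|` B) + J (A `&` B) <= J A + J B)%E) ->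
  (forall (F : (set T)^nat) G c, (forall k, C (F k)) -> C G ->
     (forall x, \forall k \near \oo, F k x <-> G x) ->
     (forall k, (J (F k) <= c)%E) -> (J G <= c)%E) ->
  exists2 E, C E & J E = ereal_inf (J @` C).
Proof.
move=> [A0 CA0] CU CI CU2 CI2 J0 Jsub Jlsc.
have infJ A : C A -> (ereal_inf (J @` C) <= J A)%E.
  by move=> CA; apply: ereal_inf_lbound; exists A.
have : (0 <= ereal_inf (J @` C))%E by apply: le_ereal_inf_tmp => _ [A _ <-].
move infE : (ereal_inf (J @` C)) => m m0.
(* If the infimum is [+oo], every competitor has infinite energy and [A0] is already a minimizer;
   [m0] excludes [-oo]. *)
case: m infE m0 => [r infE _|infE _|//]; last first.
  by exists A0 => //; apply/eqP; rewrite -leye_eq -infE infJ.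
have fin_inf : ereal_inf (J @` C) \is a fin_num by rewrite infE.
have approx k : exists A, C A /\ (J A <= (r + 2 ^- k)%:E)%E.
  have /lb_ereal_inf_adherent/(_ fin_inf)[_ [A CA <-] JA] : 0 < (2 : R) ^- k.
    by rewrite invr_gt0 exprn_gt0.
  by exists A; split => //; rewrite EFinD -infE ltW.
have [E CE] := choice approx.
(* The union has [M.+1] terms, hence at least one: [set0] need not belong to [C]. *)
pose U N M := \big[setU/set0]_(i < M.+1) E (N + i)%N.
have US N M : U N M.+1 = U N M `|` E (N + M.+1)%N by rewrite /U big_ord_recr.
have CUNM N M : C (U N M).
  elim: M => [|M IH]; first by rewrite /U big_ord1 addn0; exact: (CE N).1.
  by rewrite US; apply: CU2 => //; exact: (CE _).1.
(* The excess is the geometric sum of [2 ^- j] over [N <= j <= N + M]: each new set adds its own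
   error. *)
have JU N M : (J (U N M) <= (r + (2 * 2 ^- N - 2 ^- (N + M)))%:E)%E.
  elim: M => [|M IH].
    rewrite /U big_ord1 addn0 (_ : 2 * _ - _ = 2 ^- N); last by ring.
    exact: (CE N).2.
  rewrite US; set B := E _.
  have [CB JB] : C B /\ (J B <= (r + 2 ^- (N + M.+1))%:E)%E := CE _.
  have := le_trans (Jsub _ _ (CUNM N M) CB) (leeD IH JB).
  (* Submodularity bounds union and intersection together. The intersection is a competitor, so its
     energy is at least the finite [r], which can then be subtracted. *)
  have : (r%:E <= J (U N M `&` B))%E by rewrite -infE infJ//; exact: CI2.
  move=> /(leeD2l (J (U N M `|` B))) h /(le_trans h).
  rewrite -leeBrDr// => /le_trans; apply.
  rewrite -EFinD lee_fin addnS exprS invfM.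
  set a := 2 ^- (N + M); lra.
pose V N := \bigcup_k E (N + k)%N.
have CV N : C (V N) by apply: CU => k; exact: (CE _).1.
have JV N : (J (V N) <= (r + 2 * 2 ^- N)%:E)%E.
  apply: (Jlsc (U N)) => // [x|M].
    have [[k _ Ex]|nVx] := pselect (V N x).
      near=> M; split=> _; first by exists k.
      rewrite /U -(bigcup_mkord _ (fun k => E (N + k)%N)); exists k => //=.
      by rewrite ltnS; near: M; exact: nbhs_infty_ge.
    near=> M; split=> [|//]; rewrite /U -(bigcup_mkord _ (fun k => E (N + k)%N)) => -[k _ Ex].
    by case: nVx; exists k.
  apply: (le_trans (JU N M)); rewrite lee_fin lerD2l lerBlDr lerDl.
  by rewrite invr_ge0 exprn_ge0.
exists (\bigcap_N V N); first exact: CI.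
apply/eqP; rewrite eq_le; apply/andP; split; last first.
  by rewrite -infE infJ//; exact: CI.
have VS N M : (N <= M)%N -> V M `<=` V N.
  move=> NM x [k _ Ex]; exists (M - N + k)%N => //.
  by rewrite addnA subnKC.
apply/lee_addgt0Pr => e e0.
have [N Ne] : exists N, 2 * 2 ^- N <= e.
  have : ((2 : R) * 2^-1 ^+ k @[k --> \oo] --> (2 : R) * 0).
    apply: cvgMr; apply: cvg_expr.
    by rewrite ger0_norm ?invr_ge0// invf_lt1// ltr1n.
  rewrite mulr0 => /cvgrPdist_le/(_ e e0)[N _ /(_ N (leqnn N))] /=.
  rewrite sub0r normrN => h; exists N; rewrite -exprVn.
  exact: le_trans (ler_norm _) h.
(* Starting the tails at [N] makes the bound [r + e] hold for every term, as [Jlsc] requires. *)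
apply: (Jlsc (fun k => V (N + k)%N)) => //; first exact: CI.
  move=> x; have [Vx|nVx] := pselect ((\bigcap_N V N) x).
    by near=> k; split=> // _; exact: Vx.
  have [M nVM] : exists M, ~ V M x.
    by apply/existsNP => h; apply: nVx => M _; exact: h.
  near=> k; split=> // Vx; exfalso; apply: nVM; apply: VS Vx.
  rewrite (@leq_trans k) ?leq_addl//; near: k; exact: nbhs_infty_ge.
move=> k; apply: (le_trans (JV _)); rewrite -EFinD lee_fin lerD2l.
apply: le_trans Ne; rewrite ler_pM2l// lef_pV2 ?posrE ?exprn_gt0//.
by rewrite ler_eXn2l ?ltr1n// leq_addr.
Unshelve. all: by end_near. Qed.

(** * Lebesgue measurability of half-spaces and boxes, and sigma-finiteness *)

(** Cutting every box of a cover of [X] along the hyperplane yields covers of the two pieces of [X]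
    with the same total volume. The opposite Caratheodory inequality is subadditivity. *)
Lemma lebesgue_measurable_halfspace (R : realType) (n : nat) (i : 'I_n.+1)
  (c : R) : lebesgue_measurable [set x : 'rV[R]_n.+1 | x 0 i <= c].
Proof.
apply: le_caratheodory_measurable => X.
set H := [set x | _]; apply: le_ereal_inf_tmp => _ [I [I12 XI] <-].
(* Clamping c to the i-th edge of a box cuts the box along H without case
   analysis on the position of c. *)
pose m k := Num.max ((I k).1 0 i) (Num.min ((I k).2 0 i) c).
pose upd (a : 'rV[R]_n.+1) (t : R) : 'rV[R]_n.+1 :=
  \row_j (if j == i then t else a 0 j).
pose lo k := ((I k).1, upd (I k).2 (m k)).
pose hi k := (upd (I k).1 (m k), (I k).2).
have m1 k : (I k).1 0 i <= m k by rewrite le_max lexx.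
have m2 k : m k <= (I k).2 0 i by rewrite ge_max I12 ge_min lexx.
have lo12 k j : (lo k).1 0 j <= (lo k).2 0 j.
  by rewrite /= mxE; case: eqVneq => [->|_]; rewrite ?I12.
have hi12 k j : (hi k).1 0 j <= (hi k).2 0 j.
  by rewrite /= mxE; case: eqVneq => [->|_]; rewrite ?I12.
have ge0 (J : 'rV[R]_n.+1 * 'rV[R]_n.+1) :
    (forall j, J.1 0 j <= J.2 0 j) -> (0 <= (box_volume J)%:E)%E.
  by move=> J12; rewrite lee_fin prodr_ge0// => j _; rewrite subr_ge0.
have volE k : ((box_volume (I k))%:E =
    (box_volume (lo k))%:E + (box_volume (hi k))%:E)%E.
  have volD1 J : box_volume J =
      (J.2 0 i - J.1 0 i) * \prod_(j < n.+1 | j != i) (J.2 0 j - J.1 0 j).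
    by rewrite /box_volume (bigD1 i).
  have updE a t j : j != i -> upd a t 0 j = a 0 j.
    by move=> /negbTE ji; rewrite mxE ji.
  have updEi a t : upd a t 0 i = t by rewrite mxE eqxx.
  rewrite -EFinD !volD1 /lo /hi /= !updEi; congr EFin.
  under [X in _ = _ * X + _]eq_bigr => j ji do rewrite updE//.
  under [X in _ = _ + _ * X]eq_bigr => j ji do rewrite updE//.
  by ring.
rewrite (eq_eseriesr (fun k _ => volE k)) nneseriesD; last 2 first.
- by move=> k _ _; exact: ge0.
- by move=> k _ _; exact: ge0.
apply: leeD; apply: ereal_inf_lbound.
- exists lo => //; split=> // x [/XI[k _ xI] xH]; exists k => // j.
  rewrite !in_itv/= mxE; have := xI j; rewrite in_itv/= => /andP[-> xj]/=.
  case: eqVneq xj => // -> xi.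
  by rewrite /m le_max le_min xi; apply/orP; right.
(* Boxes exclude their lower faces: both the old lower bound and [c] lie strictly below [x 0 i],
   hence so does [m k]. *)
- exists hi => //; split=> // x [/XI[k _ xI] /negP]; rewrite -ltNge => xH.
  exists k => // j.
  rewrite !in_itv/= mxE; have := xI j; rewrite in_itv/= => /andP[xj ->].
  rewrite andbT; case: eqVneq xj => // -> xi.
  by rewrite /m gt_max xi gt_min xH orbT.
Qed.

Section lebesgue_rV_theory.
Context {R : realType} {n : nat}.
Local Notation T := (caratheodory_type (@lebesgue_outer R n)).

Lemma measurable_coordinate (i : 'I_n.+1) :
  measurable_fun setT (fun x : T => (x : 'rV[R]_n.+1) 0 i).
Proof.
apply: (measurability _ (RGenOInfty.measurableE R)) => /=.
move=> _ [_ [r -> <-]]; rewrite setTI.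
rewrite (_ : _ @^-1` _ = ~` [set x : 'rV[R]_n.+1 | x 0 i <= r]).
  apply: measurableC; exact: lebesgue_measurable_halfspace.
apply/seteqP; split => x /=; rewrite in_itv/= andbT ltNge; first by move/negP.
by move/negP.
Qed.

Lemma lebesgue_measurable_box (I : 'rV[R]_n.+1 * 'rV[R]_n.+1) :
  lebesgue_measurable (box I).
Proof.
have -> : box I = \bigcap_(i in [set: 'I_n.+1])
    ((fun x : T => (x : 'rV[R]_n.+1) 0 i) @^-1` `]I.1 0 i, I.2 0 i]).
  by apply/seteqP; split=> [x xI i _|x xI i]; apply: xI.
apply: fin_bigcap_measurable => // i _.
by rewrite -[X in measurable X]setTI; exact: measurable_coordinate.
Qed.

Lemma lebesgue_rV_sigma_finite : sigma_finite setT (@lebesgue_rV R n).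
Proof.
pose I k : 'rV[R]_n.+1 * 'rV[R]_n.+1 := (const_mx (- k%:R), const_mx k%:R).
exists (fun k => box (I k)).
  apply/esym/seteqP; split=> // x _.
  near \oo => k; exists k => // i; rewrite in_itv/= !mxE.
  have : `|(x : 'rV[R]_n.+1) 0 i| < k%:R.
    (* Bounding by the sum of all coordinates makes the choice of [k] uniform in [i]. *)
    apply: (@le_lt_trans _ _ (\sum_j `|(x : 'rV[R]_n.+1) 0 j|)).
      by rewrite (bigD1 i)//= lerDl sumr_ge0.
    near: k; exact: nbhs_infty_gtr.
  by rewrite ltr_norml => /andP[-> /ltW].
move=> k; split; first exact: lebesgue_measurable_box.
have I12 i : (I k).1 0 i <= (I k).2 0 i.
  by rewrite !mxE (@le_trans _ _ 0)// oppr_le0.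
apply: (@le_lt_trans _ _ (box_volume (I k))%:E); last exact: ltry.
apply: ereal_inf_lbound.
(* The cube covers itself; the padding boxes [(0, 0)] have volume 0 because the dimension is
   positive. *)
exists (fun j => if j == 0%N then I k else (0, 0)).
  by split=> [[|j] i|x xI]; [exact: I12|exact: lexx|exists 0%N].
rewrite nneseries_recl//; last first.
  move=> [_|j _]; rewrite lee_fin prodr_ge0// => i _; rewrite subr_ge0//.
rewrite eseries0 ?adde0// => -[//|j] _ _.
by rewrite /box_volume big_ord_recl subrr mul0r.
Unshelve. all: by end_near. Qed.

End lebesgue_rV_theory.

(** * Nonlocal energies for a nonnegative kernel on a sigma-finite space *)

Section nonlocal_energy.
Context {d : measure_display} {T : measurableType d} {R : realType}.
Variable mu : {sigma_finite_measure set T -> \bar R}.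
Variable K : T * T -> R.
Hypothesis mK : measurable_fun setT K.
Hypothesis K0 : forall z, 0 <= K z.

(** With the indicators inside the integrand, all integrals run over the whole space and energies of
    different sets compare pointwise. *)
Let cell (A B : set T) (z : T * T) : \bar R :=
  (K z * (\1_A z.1 * \1_B z.2))%:E.

Definition nonlocal_energy (E : set T) : \bar R :=
  (\int[mu]_x \int[mu]_y cell E (~` E) (x, y))%E.

Let cell0 A B z : (0 <= cell A B z)%E.
Proof. by rewrite lee_fin mulr_ge0// mulr_ge0. Qed.

Let mcell A B : measurable A -> measurable B -> measurable_fun setT (cell A B).
Proof.
move=> mA mB; apply/measurable_EFinP; apply: measurable_funM => //.
by apply: measurable_funM; apply: measurableT_comp => //;
  exact: measurable_indic.
Qed.

Let mcell1 A B x : measurable A -> measurable B ->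
  measurable_fun setT (fun y => cell A B (x, y)).
Proof. by move=> mA mB; apply: measurable_fun_pair2; exact: mcell. Qed.

Let cellF0 A B x : (0 <= \int[mu]_y cell A B (x, y))%E.
Proof. exact: integral_ge0. Qed.

(** Sigma-finiteness of [mu] enters here, through the measurability of partial integrals in
    Tonelli's theorem. *)
Let mcellF A B : measurable A -> measurable B ->
  measurable_fun setT (fun x => \int[mu]_y cell A B (x, y))%E.
Proof.
move=> mA mB.
exact: (measurable_fun_fubini_tonelli_F (m2 := mu) _ (mcell _ _ mA mB)
  (cell0 A B)).
Qed.

Let integral_cellD A B A' B' : measurable A -> measurable B ->
  measurable A' -> measurable B' ->
  (\int[mu]_x \int[mu]_y cell A B (x, y) +
   \int[mu]_x \int[mu]_y cell A' B' (x, y) =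
   \int[mu]_x \int[mu]_y (cell A B (x, y) + cell A' B' (x, y)))%E.
Proof.
move=> mA mB mA' mB'.
rewrite -(ge0_integralD mu measurableT (fun x _ => cellF0 A B x)
  (mcellF _ _ mA mB) (fun x _ => cellF0 A' B' x) (mcellF _ _ mA' mB')).
apply: eq_integral => x _.
by rewrite -(ge0_integralD mu measurableT (fun y _ => cell0 A B (x, y))
  (mcell1 _ _ x mA mB) (fun y _ => cell0 A' B' (x, y)) (mcell1 _ _ x mA' mB')).
Qed.

Let integral_cell A B :
  (\int[mu]_(x in A) \int[mu]_(y in B) (K (x, y))%:E =
   \int[mu]_x \int[mu]_y cell A B (x, y))%E.
Proof.
rewrite integral_mkcond; apply: eq_integral => x _.
rewrite patchE; case: ifPn => xA.
  rewrite integral_mkcond; apply: eq_integral => y _.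
  rewrite patchE /cell/= !indicE xA mul1r.
  by case: ifPn => yB; rewrite ?mulr1 ?mulr0.
apply/esym/integral0_eq => y _.
by rewrite /cell/= indicE (negbTE xA) mul0r mulr0.
Qed.

Lemma nonlocal_energy_ge0 E : (0 <= nonlocal_energy E)%E.
Proof. exact: integral_ge0. Qed.

Lemma nonlocal_energy_submodular A B : measurable A -> measurable B ->
  (nonlocal_energy (A `|` B) + nonlocal_energy (A `&` B) <=
   nonlocal_energy A + nonlocal_energy B)%E.
Proof.
move=> mA mB.
have mU := measurableU _ _ mA mB; have mI := measurableI _ _ mA mB.
have mCA := measurableC mA; have mCB := measurableC mB.
have mCU := measurableC mU; have mCI := measurableC mI.
have mcellD A1 B1 A2 B2 x : measurable A1 -> measurable B1 ->
    measurable A2 -> measurable B2 ->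
    measurable_fun setT (fun y => cell A1 B1 (x, y) + cell A2 B2 (x, y))%E.
  by move=> *; apply: emeasurable_funD; exact: mcell1.
have mcellFD A1 B1 A2 B2 : measurable A1 -> measurable B1 ->
    measurable A2 -> measurable B2 -> measurable_fun setT
    (fun x => \int[mu]_y (cell A1 B1 (x, y) + cell A2 B2 (x, y)))%E.
  move=> m1 m2 m3 m4; apply: (measurable_fun_fubini_tonelli_F (m2 := mu)
    (fun z => cell A1 B1 z + cell A2 B2 z)%E).
    by apply: emeasurable_funD; exact: mcell.
  by move=> z; rewrite adde_ge0.
rewrite [leLHS](integral_cellD _ _ _ _ mU mCU mI mCI).
rewrite [leRHS](integral_cellD _ _ _ _ mA mCA mB mCB).
apply: ge0_le_integral.
- exact: measurableT.
- by move=> x _; apply: integral_ge0 => y _; rewrite adde_ge0.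
- exact: mcellFD.
- exact: mcellFD.
move=> x _; apply: ge0_le_integral.
- exact: measurableT.
- by move=> y _; rewrite adde_ge0.
- exact: mcellD.
- exact: mcellD.
(* The right-hand indicator sum exceeds the left one, by 1, exactly when one of [x], [y] lies in [A]
   only and the other in [B] only; otherwise they agree. *)
move=> y _; rewrite -!EFinD lee_fin -!mulrDr ler_wpM2l// !indicE /=.
rewrite !in_setC !in_setU !in_setI.
by case: (x \in A); case: (x \in B); case: (y \in A); case: (y \in B) => /=;
  lra.
Qed.

(** Fatou's lemma is applied twice, first in [y] at fixed [x], then in [x]. *)
Lemma nonlocal_energy_lsc (F : (set T)^nat) (G : set T) (c : \bar R) :
  (forall k, measurable (F k)) -> measurable G ->
  (forall x, \forall k \near \oo, F k x <-> G x) ->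
  (forall k, (nonlocal_energy (F k) <= c)%E) -> (nonlocal_energy G <= c)%E.
Proof.
move=> mF mG FG Fc.
have measurable_einf (f : (T -> \bar R)^nat) : (forall k, measurable_fun setT (f k)) ->
    measurable_fun setT (fun x => limn_einf (f ^~ x)).
  move=> mf; apply: measurableT_comp => //.
  by apply: measurable_fun_limn_esup => k; exact: measurableT_comp.
(* At a fixed pair the integrand depends only on the membership of two points, so it is eventually
   constant in [k]. *)
have cellE x y : cell G (~` G) (x, y) = limn_einf (fun k => cell (F k) (~` F k) (x, y)).
  apply/esym; apply: (@cvg_limn_einf_sup _ _ _ _).1.
  apply: cvg_near_cst; near=> k.
  have FxE : (x \in F k) = (x \in G).
    have FGx : F k x <-> G x by near: k; exact: FG.
    by apply/idP/idP; rewrite !inE => /FGx.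
  have FyE : (y \in F k) = (y \in G).
    have FGy : F k y <-> G y by near: k; exact: FG.
    by apply/idP/idP; rewrite !inE => /FGy.
  by rewrite /cell/= !indicE !in_setC FxE FyE.
have fatou_y x : (\int[mu]_y cell G (~` G) (x, y) <=
    limn_einf (fun k => \int[mu]_y cell (F k) (~` F k) (x, y)))%E.
  under eq_integral do rewrite cellE.
  by apply: fatou => // k; apply: mcell1 => //; exact: measurableC.
apply: (@le_trans _ _ (limn_einf (fun k => nonlocal_energy (F k)))).
  apply: (@le_trans _ _ (\int[mu]_x
      limn_einf (fun k => \int[mu]_y cell (F k) (~` F k) (x, y)))%E).
    apply: ge0_le_integral => //; first by
      apply: mcellF => //; exact: measurableC.
    by apply: measurable_einf => k; apply: mcellF => //; exact: measurableC.
  by apply: fatou => // k; apply: mcellF => //; exact: measurableC.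
apply: (le_trans (limn_einf_sup _)).
rewrite limn_esup_lim; apply: lime_le; first exact: is_cvg_esups.
near=> k; apply: ge_ereal_sup => _ [j _ <-]; exact: Fc.
Unshelve. all: by end_near. Qed.

(** The added weight is the indicator that [x] or [y] lies in [Omega]. The two interactions split
    the pairs from [E] to its complement with this property according to whether [x] is in
    [Omega]. *)
Lemma perimeter_nonlocal_energy (E Omega : set T) :
  measurable E -> measurable Omega ->
  (\int[mu]_(x in E `&` Omega) \int[mu]_(y in ~` E) (K (x, y))%:E +
   \int[mu]_(x in E `\` Omega) \int[mu]_(y in ~` E `&` Omega)
     (K (x, y))%:E =
   \int[mu]_x \int[mu]_y (K (x, y) *
     (\1_Omega x + \1_(~` Omega) x * \1_Omega y) *
     (\1_E x * \1_(~` E) y))%:E)%E.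
Proof.
move=> mE mO; have mCE := measurableC mE.
have mEO := measurableI _ _ mE mO; have mEDO := measurableD mE mO.
have mCEO := measurableI _ _ mCE mO.
rewrite !integral_cell (integral_cellD _ _ _ _ mEO mCE mEDO mCEO).
apply: eq_integral => x _; apply: eq_integral => y _.
rewrite -EFinD /cell/= !indicE !in_setD !in_setI !in_setC; congr EFin.
by case: (x \in E); case: (x \in Omega); case: (y \in E); case: (y \in Omega);
  rewrite /=; ring.
Qed.

End nonlocal_energy.

(** * Measurability of the Euclidean distance and of open sets *)

Section euclidean.
Context {R : realType} {n : nat}.
Local Notation T := (caratheodory_type (@lebesgue_outer R n)).

HB.instance Definition _ := Measure_isSigmaFinite.Build _ _ _
  (@lebesgue_rV R n) (@lebesgue_rV_sigma_finite R n).

Lemma measurable_enorm_sub :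
  measurable_fun setT (fun z : T * T => enorm ((z.1 : 'rV[R]_n.+1) - z.2)).
Proof.
rewrite (_ : (fun _ => _) = fun z : T * T =>
    (\sum_(i < n.+1) ((z.1 : 'rV[R]_n.+1) - z.2) 0 i ^+ 2) `^ 2^-1); last first.
  apply/funext => z; rewrite powR12_sqrt// sumr_ge0// => i _.
  exact: sqr_ge0.
apply: (measurableT_comp (@measurable_powR R _)).
apply: measurable_sum => i; apply: measurable_funX.
under eq_fun do rewrite !mxE.
apply: measurable_funB.
  exact: (measurableT_comp (measurable_coordinate i) measurable_fst).
exact: (measurableT_comp (measurable_coordinate i) measurable_snd).
Qed.

Lemma open_lebesgue_measurable (U : set 'rV[R]_n.+1) :
  open U -> lebesgue_measurable U.
Proof.
move=> oU.
pose B (q : 'rV[rat]_n.+1 * 'rV[rat]_n.+1) :=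
  box (map_mx ratr q.1, map_mx ratr q.2 : 'rV[R]_n.+1).
(* Replacing the boxes not contained in [U] by [set0] lets the union run over all rational pairs, a
   countable index type. *)
have -> : U = \bigcup_q (if pselect (B q `<=` U) then B q else set0).
  apply/seteqP; split=> [x Ux|x [q _]]; last by case: pselect => // BU /BU.
  have /nbhs_ballP[e e0 xe] : nbhs x U by exact: open_nbhs_nbhs.
  have lo i : exists q : rat, x 0 i - e < ratr q < x 0 i.
    have [|q] := @rat_in_itvoo R (x 0 i - e) (x 0 i).
      by rewrite ltrBlDr ltrDl.
    by rewrite in_itv => qI; exists q.
  have hi i : exists q : rat, x 0 i < ratr q < x 0 i + e.
    have [|q] := @rat_in_itvoo R (x 0 i) (x 0 i + e).
      by rewrite ltrDl.
    by rewrite in_itv => qI; exists q.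
  have [a aP] := choice lo; have [b bP] := choice hi.
  exists (\row_i a i, \row_i b i) => //.
  case: pselect => [? /=|]; last case.
    move=> i; rewrite in_itv/= !mxE.
    by have /andP[_ ->] := aP i; have /andP[/ltW] := bP i.
  (* Balls of the sup norm are products of intervals, so the check is coordinatewise. *)
  move=> y yB; apply: xe; split=> // j i; rewrite (ord1 j).
  have := yB i; rewrite in_itv/= !mxE => /andP[ay yb].
  have /andP[xa _] := aP i; have /andP[_ bx] := bP i.
  rewrite /ball/= ltr_distlC; apply/andP; split.
    exact: lt_trans ay.
  exact: le_lt_trans bx.
apply: (@countable_bigcupT_measurable _ T) => // q.
case: pselect => [?|?]; first exact: lebesgue_measurable_box.
exact: measurable0.
Qed.

End euclidean.

(** * Minimizers of the fractional perimeter with prescribed exterior data *)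

Theorem theorem3p10 (R : realType) (n : nat) (s : R)
    (Omega E0 : set 'rV[R]_n.+1) :
  0 < s < 1 ->
  open Omega -> bounded_set Omega -> lipschitz_boundary Omega ->
  lebesgue_measurable E0 -> E0 `<=` ~` Omega ->
  exists E : set 'rV[R]_n.+1,
    [/\ lebesgue_measurable E,
        E `\` Omega = E0 &
        frac_perimeter s E Omega =
        ereal_inf [set frac_perimeter s F Omega | F in
          [set F : set 'rV[R]_n.+1 |
             lebesgue_measurable F /\ F `\` Omega = E0]]].
Proof.
move=> _ /open_lebesgue_measurable mO _ _ mE0 E0O.
pose T := caratheodory_type (@lebesgue_outer R n).
pose mu : {sigma_finite_measure set T -> \bar R} := @lebesgue_rV R n.
pose k (z : T * T) : R :=
  (enorm ((z.1 : 'rV[R]_n.+1) - z.2) `^ (n.+1%:R + s))^-1.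
have mk : measurable_fun setT k.
  rewrite /k; under eq_fun do rewrite -powRN.
  apply: (measurableT_comp (@measurable_powR R _)).
  exact: measurable_enorm_sub.
have k0 z : 0 <= k z by rewrite invr_ge0 powR_ge0.
pose K (z : T * T) : R :=
  k z * (\1_Omega z.1 + \1_(~` Omega) z.1 * \1_Omega z.2).
have mK : measurable_fun setT K.
  have mind (A : set T) : measurable A -> measurable_fun setT (\1_A : T -> R).
    exact: measurable_indic.
  apply: measurable_funM => //; apply: measurable_funD.
    by apply: measurableT_comp => //; exact: mind.
  apply: measurable_funM; apply: measurableT_comp => //; apply: mind => //.
  exact: measurableC.
have K0 z : 0 <= K z by rewrite mulr_ge0// addr_ge0// mulr_ge0.
pose C : set (set T) := [set F | lebesgue_measurable F /\ F `\` Omega = E0].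
pose J := nonlocal_energy mu K.
have JE F : lebesgue_measurable F -> frac_perimeter s F Omega = J F.
  by move=> mF; exact: (perimeter_nonlocal_energy mu k mk k0 F Omega mF mO).
(* The exterior condition becomes a pointwise one off [Omega], which passes directly to unions and
   intersections; this direction relies on [E0O]. *)
have CP (F : set T) : lebesgue_measurable F ->
    (forall x, ~ Omega x -> F x <-> E0 x) -> C F.
  move=> mF FE0; split=> //; apply/seteqP; split => x.
    by move=> [Fx Ox]; apply/FE0.
  by move=> E0x; split; [apply/FE0 => //|]; exact: E0O.
have CE0 (F : set T) : C F -> forall x, ~ Omega x -> F x <-> E0 x.
  by move=> [_ <-] x Ox; split=> [//|[]].
have [E [mE EO] JEinf] : exists2 E, C E & J E = ereal_inf (J @` C).
  apply: submodular_has_minimum.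
  - by exists E0; apply: CP.
  - move=> F CF; apply: CP.
      by apply: (@bigcupT_measurable _ T) => k'; exact: (CF k').1.
    move=> x Ox; split=> [[i _]|E0x]; first by move/(CE0 _ (CF i) _ Ox).
    by exists 0%N => //; apply/(CE0 _ (CF 0%N) _ Ox).
  - move=> F CF; apply: CP.
      by apply: (@bigcapT_measurable _ T) => k'; exact: (CF k').1.
    move=> x Ox; split=> [/(_ 0%N I)|E0x i _]; first by move/(CE0 _ (CF 0%N) _ Ox).
    by apply/(CE0 _ (CF i) _ Ox).
  - move=> A B CA CB; apply: CP.
      by apply: (@measurableU _ T); [exact: CA.1|exact: CB.1].
    move=> x Ox; have := CE0 _ CA _ Ox; have := CE0 _ CB _ Ox.
    by rewrite /setU/=; tauto.
  - move=> A B CA CB; apply: CP.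
      by apply: (@measurableI _ T); [exact: CA.1|exact: CB.1].
    move=> x Ox; have := CE0 _ CA _ Ox; have := CE0 _ CB _ Ox.
    by rewrite /setI/=; tauto.
  - by move=> A; exact: nonlocal_energy_ge0.
  - by move=> A B [mA _] [mB _]; exact: nonlocal_energy_submodular.
  - move=> F G c CF [mG _]; apply: nonlocal_energy_lsc => // i.
    exact: (CF i).1.
exists E; split => //; rewrite JE// JEinf; congr ereal_inf.
by apply/seteqP; split=> _ [F CF <-]; exists F => //; rewrite JE//; exact: CF.1.
Qed.
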